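(* Over $\mathfrak{S}_n$, the following quadruples of statistics all have the same joint distribution: (1) $(\mathsf{inv},\mathsf{rmin},\mathsf{lmin},\mathsf{lmax})$; (2) $(\mathsf{sor},\mathsf{cyc},\mathsf{lmic}_1,\mathsf{lmax})$; (3) $(\mathsf{inv},\mathsf{lmax},\mathsf{lmin},\mathsf{rmin})$; (4) $(\mathsf{inv},\mathsf{rmin},\mathsf{rmax},\mathsf{lmax})$; (5) $(\mathsf{inv},\mathsf{lmax},\mathsf{rmax},\mathsf{rmin})$; (6) $(\binom n2-\mathsf{inv},\mathsf{lmin},\mathsf{rmin},\mathsf{rmax})$; (7) $(\binom n2-\mathsf{inv},\mathsf{rmax},\mathsf{lmax},\mathsf{lmin})$; (8) $(\binom n2-\mathsf{inv},\mathsf{rmax},\mathsf{rmin},\mathsf{lmin})$; (9) $(\binom n2-\mathsf{inv},\mathsf{lmin},\mathsf{lmax},\mathsf{rmax})$; (10) $(\mathsf{sor},\mathsf{lmax},\mathsf{lmic}_1,\mathsf{cyc})$. Moreover, the following partial quadruples (a dash means the entry is omitted) have the same joint distribution as the entries in the same positions of quadruple (1): (11) $(\binom n2-\mathsf{sor},\mathsf{lmic}_1,\mathsf{cyc},-)$; (12) $(\binom n2-\mathsf{sor},-,\mathsf{lmax},\mathsf{lmic}_1)$; (13) $(\binom n2-\mathsf{sor},-,\mathsf{cyc},\mathsf{lmic}_1)$; (14) $(\binom n2-\mathsf{sor},\mathsf{lmic}_1,\mathsf{lmax},-)$; (15) $(-,\mathsf{cyc},-,\mathsf{rmin})$; (16)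 $(-,\mathsf{rmin},-,\mathsf{cyc})$; (17) $(\mathsf{maj},\mathsf{rmin},\mathsf{rmax},-)$; (18) $(\mathsf{imaj},\mathsf{lmax},\mathsf{rmax},-)$; (19) $(\mathsf{rmaj},\mathsf{lmax},\mathsf{lmin},-)$; (20) $(\mathsf{chg},\mathsf{rmin},\mathsf{lmin},-)$; (21) $(\mathsf{cochg},\mathsf{lmin},\mathsf{rmin},-)$. Consequently, for each (partial) quadruple $(s_1,s_2,s_3,\cdot)$ above whose first three entries are all present, $$\sum_{\sigma\in\mathfrak{S}_n}q^{s_1(\sigma)}x^{s_2(\sigma)}y^{s_3(\sigma)}=xy\prod_{r=2}^{n}\bigl(x+[r]_q+yq^{r-1}-1-q^{r-1}\bigr),$$ where $[r]_q=1+q+\dots+q^{r-1}$.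
   Context: $\mathfrak{S}_n$ is the symmetric group on $[n]$, permutations in one-line notation $\sigma=\sigma_1\cdots\sigma_n$, products composed right to left. $\mathsf{inv}(\sigma)=\#\{(i,j):i<j,\ \sigma_i>\sigma_j\}$. $\mathsf{rmin},\mathsf{rmax},\mathsf{lmin},\mathsf{lmax}$ are the numbers of right-to-left minima, right-to-left maxima, left-to-right minima, left-to-right maxima of $\sigma$ (e.g. $\mathsf{rmin}(\sigma)=\#\{i:\sigma_i<\sigma_j\ \forall j>i\}$, $\mathsf{lmax}(\sigma)=\#\{i:\sigma_i>\sigma_j\ \forall j<i\}$). $\mathsf{cyc}(\sigma)$ is the number of cycles of $\sigma$. Sorting index: write $\sigma=(i_1\,j_1)\cdots(i_k\,j_k)$ uniquely with $j_1<\dots<j_k$, $i_r<j_r$; $\mathsf{sor}(\sigma)=\sum_r(j_r-i_r)$. $B$-code: $B(\sigma)=(b_1,\dots,b_n)$, $b_i=\sigma^{-k_i}(i)$ with $k_i\ge1$ smallest such that $\sigma^{-k_i}(i)\le i$; $\mathsf{lmic}_1(\sigma)=\#\{i:b_i=1\}$. Reverse $\sigma^r=\sigma_n\cdots\sigma_1$, complement $\sigma^c=(n+1-\sigma_1)\cdots(n+1-\sigma_n)$, $\sigma^{rc}=(\sigma^c)^r$. $\mathsf{Des}(\sigma)=\{i\in[n-1]:\sigma_i>\sigma_{i+1}\}$; $\mathsf{maj}(\sigma)=\sum_{i\in\mathsf{Des}(\sigma)}i$; $\mathsf{imaj}(\sigma)=\mathsf{maj}(\sigma^{-1})$; $\mathsf{rmaj}(\sigma)=\mathsf{maj}(\sigma^{rc})$;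 $\mathsf{chg}(\sigma)=\sum_{i\in\mathsf{Des}(\sigma^{-1})}(n-i)$; $\mathsf{cochg}(\sigma)=\sum_{i\in[n-1]\setminus\mathsf{Des}(\sigma^{-1})}(n-i)$. *)

(* Defs.v *)
From HB Require Import structures.
From mathcomp Require Import all_boot all_order all_fingroup all_algebra.
Set Implicit Arguments.
Unset Strict Implicit.
Unset Printing Implicit Defensive.
Import GRing.Theory.

(* Permutations of [n] are elements of 'S_n = {perm 'I_n}, so positions and
   values are shifted down by one: i : 'I_n stands for i.+1 in [n]. MathComp
   composes permutations left to right: (s * t) i = t (s i). *)

Section Statistics.
Variable n : nat.
Implicit Types (s : 'S_n) (w : seq ('I_n * 'I_n)).

Definition ninv s : nat :=
  #|[set p : 'I_n * 'I_n | (p.1 < p.2) && (s p.2 < s p.1)]|.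

Definition rmin s : nat :=
  #|[set i : 'I_n | [forall j : 'I_n, (i < j) ==> (s i < s j)]]|.
Definition rmax s : nat :=
  #|[set i : 'I_n | [forall j : 'I_n, (i < j) ==> (s j < s i)]]|.
Definition lmin s : nat :=
  #|[set i : 'I_n | [forall j : 'I_n, (j < i) ==> (s i < s j)]]|.
Definition lmax s : nat :=
  #|[set i : 'I_n | [forall j : 'I_n, (j < i) ==> (s j < s i)]]|.

(* Fixed points count as cycles. *)
Definition cyc s : nat := #|porbits s|.

(* w = [:: (i_1, j_1); ...; (i_k, j_k)] is the factorisation
   s = (i_1 j_1) ... (i_k j_k), i_r < j_r, j_1 < ... < j_k, where the product
   is composed right to left; hence the rev. *)
Definition sort_fact s w : bool :=
  [&& all (fun t : 'I_n * 'I_n => t.1 < t.2) w,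
      sorted ltn [seq val t.2 | t <- w]
    & s == (\prod_(t <- rev w) tperm t.1 t.2)%g].

Lemma sort_fact_rcons s w (i j : 'I_n) :
  sort_fact s (rcons w (i, j)) =
  [&& i < j, all (fun t : 'I_n * 'I_n => t.2 < j) w & sort_fact (tperm i j * s)%g w].
Proof.
rewrite /sort_fact all_rcons /= map_rcons rev_rcons big_cons /=.
have -> : (s == tperm i j * \prod_(t <- rev w) tperm t.1 t.2)%g =
    (tperm i j * s == \prod_(t <- rev w) tperm t.1 t.2)%g.
  by rewrite -(inj_eq (mulgI (tperm i j)) s) mulgA tperm2 mul1g.
have -> : sorted ltn (rcons [seq val t.2 | t <- w] j) =
    all (fun t : 'I_n * 'I_n => t.2 < j) w && sorted ltn [seq val t.2 | t <- w].
  rewrite -[rcons _ _]revK rev_sorted rev_rcons /=.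
  rewrite path_sortedE; last by move=> a b c ba ac; apply: ltn_trans ac ba.
  by rewrite all_rev all_map -rev_sorted revK.
by case: (i < j); rewrite ?andbF //=; case: (all (fun t : 'I_n * 'I_n => t.2 < j) w);
  rewrite ?andbF.
Qed.

Lemma sort_fact_fix s w (m : nat) (i : 'I_n) :
  sort_fact s w -> all (fun t : 'I_n * 'I_n => t.2 < m) w -> m <= i -> s i = i.
Proof.
case/and3P=> lt_w _ /eqP->.
elim/last_ind: w lt_w => [|w t IHw]; first by rewrite big_nil perm1.
rewrite !all_rcons rev_rcons big_cons permM => /andP[lt_t lt_w] /andP[tm wm] mi.
rewrite tpermD ?IHw //; rewrite -val_eqE neq_ltn.
  by rewrite (ltn_trans lt_t (leq_trans tm mi)).
by rewrite (leq_trans tm mi).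
Qed.

Lemma sort_fact_ex s : exists w, sort_fact s w.
Proof.
suff ex_m m s' : m <= n -> (forall i : 'I_n, m <= i -> s' i = i) ->
    exists2 w, sort_fact s' w & all (fun t : 'I_n * 'I_n => t.2 < m) w.
  have [i|w sw _] := ex_m n s (leqnn n); last by exists w.
  by rewrite leqNgt ltn_ord.
elim: m s' => {s} [|m IHm] s le_mn fix_s.
  exists [::] => //; rewrite /sort_fact /= big_nil; apply/eqP/permP=> i.
  by rewrite perm1 fix_s.
pose j := Ordinal le_mn; pose i := (s^-1)%g j.
have si : s i = j by rewrite permKV.
have le_ij : i <= j.
  by rewrite leqNgt; apply/negP=> lt_ji; move: (lt_ji); rewrite -(fix_s i) // si ltnn.
case: (eqVneq i j) => [eq_ij | ne_ij].
  have [||w sw wm] := IHm s; first exact: ltnW.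
    move=> k; rewrite leq_eqVlt => /predU1P[mk|]; last exact: fix_s.
    have -> : k = j by apply: val_inj.
    by rewrite -{1}eq_ij.
  by exists w => //; apply: sub_all wm => t /ltnW.
have lt_ij : i < j by rewrite ltn_neqAle le_ij andbT.
have [||w sw wm] := IHm (tperm i j * s)%g; first exact: ltnW.
  move=> k; rewrite permM leq_eqVlt => /predU1P[mk|lt_mk].
    have -> : k = j by apply: val_inj.
    by rewrite tpermR.
  rewrite tpermD ?fix_s //; rewrite -val_eqE neq_ltn; last by rewrite lt_mk.
  by rewrite (ltn_trans lt_ij lt_mk).
exists (rcons w (i, j)); first by rewrite sort_fact_rcons lt_ij sw wm.
by rewrite all_rcons /= ltnSn; apply: sub_all wm => t /ltnW.
Qed.

Lemma sort_fact_uniq s w1 w2 : sort_fact s w1 -> sort_fact s w2 -> w1 = w2.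
Proof.
have last_moved s' w (i j : 'I_n) : sort_fact s' (rcons w (i, j)) ->
    [/\ i < j, s' i = j & forall k : 'I_n, j < k -> s' k = k].
  move=> sw; move: (sw); rewrite sort_fact_rcons => /and3P[lt_ij wj sw'].
  split=> //.
    by rewrite -(sort_fact_fix sw' wj (leqnn j)) permM tpermR.
  move=> k; apply: sort_fact_fix sw _; rewrite all_rcons /= ltnSn.
  by apply: sub_all wj => t /ltnW.
have not1 w i j : ~ sort_fact 1%g (rcons w (i, j)).
  by case/last_moved; rewrite perm1 => lt_ij eq_ij; move: lt_ij; rewrite eq_ij ltnn.
have nilE s' : sort_fact s' [::] -> s' = 1%g.
  by rewrite /sort_fact /= big_nil => /eqP.
elim/last_ind: w1 s w2 => [|w1 [i1 j1] IHw] s w2; case/lastP: w2 => [|w2 [i2 j2]] //.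
- by move/nilE-> => /not1.
- by move=> h /nilE s1; move: h; rewrite s1 => /not1.
move=> sw1 sw2; have [lt1 e1 f1] := last_moved _ _ _ _ sw1.
have [lt2 e2 f2] := last_moved _ _ _ _ sw2.
have ej : j1 = j2.
  apply: val_inj; case: (ltngtP (val j1) (val j2)) => // lt_j.
    have := f1 _ lt_j; rewrite -{2}e2 => /perm_inj eq_ij.
    by move: lt2; rewrite -eq_ij ltnn.
  have := f2 _ lt_j; rewrite -{2}e1 => /perm_inj eq_ij.
  by move: lt1; rewrite -eq_ij ltnn.
have ei : i1 = i2 by apply: (@perm_inj _ s); rewrite e1 e2.
move: sw1 sw2; rewrite !sort_fact_rcons -ej -ei => /and3P[_ _ h1] /and3P[_ _ h2].
by rewrite (IHw _ _ h1 h2).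
Qed.

Definition sor s : nat :=
  \sum_(t <- xchoose (sort_fact_ex s)) (t.2 - t.1).

Lemma Bcode_ex s (i : 'I_n) : exists k : nat, (0 < k) && ((s ^- k)%g i <= i).
Proof. by exists #[s]%g; rewrite order_gt0 expg_order invg1 perm1 leqnn. Qed.

Definition Bcode s (i : 'I_n) : 'I_n := (s ^- ex_minn (Bcode_ex s i))%g i.

(* The value 1 of [n] is encoded as 0. *)
Definition lmic1 s : nat := #|[set i : 'I_n | Bcode s i == 0 :> nat]|.

Definition revp s : 'S_n := (perm (@rev_ord_inj n) * s)%g.
Definition compl s : 'S_n := (s * perm (@rev_ord_inj n))%g.

(* The descent at position i.+1 of [n - 1] is encoded as i. *)
Definition Des s : {set 'I_n} :=
  [set i : 'I_n | [exists j : 'I_n, (j == i.+1 :> nat) && (s j < s i)]].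

Definition maj s : nat := \sum_(i in Des s) i.+1.
Definition imaj s : nat := maj s^-1%g.
Definition rmaj s : nat := maj (revp (compl s)).
Definition chg s : nat := \sum_(i in Des s^-1%g) (n - i.+1).
Definition cochg s : nat :=
  \sum_(i : 'I_n | (i.+1 < n) && (i \notin Des s^-1%g)) (n - i.+1).

(* The next two lemmas show that these truncated subtractions are exact. *)
Definition coinv s : nat := 'C(n, 2) - ninv s.
Definition cosor s : nat := 'C(n, 2) - sor s.

Lemma ninv_le s : ninv s <= 'C(n, 2).
Proof.
rewrite -bin2_sum big_mkord.
have -> : \sum_(j < n) j = #|[set p : 'I_n * 'I_n | p.1 < p.2]|.
  rewrite -sum1dep_card -(pair_big_dep xpredT (fun i j : 'I_n => i < j) (fun _ _ => 1)) /=.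
  rewrite (exchange_big_dep xpredT) //=; apply: eq_bigr => j _.
  rewrite sum1_card -[LHS]card_ord.
  have lt_in (i : 'I_j) : i < n by apply: ltn_trans (ltn_ord j).
  have inj_f : injective (fun i : 'I_j => Ordinal (lt_in i)).
    by move=> i k /(congr1 val) /= /val_inj.
  rewrite -(card_codom inj_f); apply: eq_card => i; rewrite [RHS]unfold_in.
  apply/codomP/idP => [[k ->] /=|lt_ij]; first exact: ltn_ord.
  by exists (Ordinal lt_ij); apply: val_inj.
by apply: subset_leq_card; apply/subsetP=> p; rewrite !inE => /andP[].
Qed.

Lemma sor_le s : sor s <= 'C(n, 2).
Proof.
rewrite /sor; case/and3P: (xchooseP (sort_fact_ex s)).
move: (xchoose _) => w _ srt _.
apply: (@leq_trans (\sum_(t <- w) t.2)).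
  by apply: leq_sum => t _; apply: leq_subr.
rewrite -bin2_sum -(big_map (fun t : 'I_n * 'I_n => t.2) xpredT (fun j : 'I_n => val j)).
rewrite big_mkord (big_uniq _) /=; last first.
  by rewrite -(map_inj_uniq val_inj) -map_comp; apply: (sorted_uniq ltn_trans ltnn).
by rewrite [leqLHS]big_mkcond; apply: leq_sum => j _; case: ifP.
Qed.

Definition equidistributed (T : eqType) (f g : 'S_n -> T) : Prop :=
  forall v : T, #|[set s | f s == v]| = #|[set s | g s == v]|.

Local Open Scope ring_scope.

Definition qint (R : comNzRingType) (q : R) (r : nat) : R :=
  \sum_(i < r) q ^+ i.

(* Identity of polynomials in q, x, y, stated as an identity under every
   evaluation of q, x, y in a commutative ring. *)
Definition gf_identity (s1 s2 s3 : 'S_n -> nat) : Prop :=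
  forall (R : comNzRingType) (q x y : R),
    \sum_(s : 'S_n) q ^+ s1 s * x ^+ s2 s * y ^+ s3 s =
    x * y * \prod_(2 <= r < n.+1)
      (x + qint q r + y * q ^+ (r - 1) - 1 - q ^+ (r - 1)).

End Statistics.

(* Main.v *)
Require Import Defs.
From mathcomp Require Import all_boot all_order all_fingroup all_algebra.
From mathcomp Require Import zify ring.
Set Implicit Arguments.
Unset Strict Implicit.
Unset Printing Implicit Defensive.
Import GRing.Theory.

(* A permutation of [n + 1] arises from a permutation s of [n] and a position i
   in two ways: by inserting the value n + 1 at position i, or by multiplying s
   by the transposition (i, n + 1). The first way changes inv, rmin and lmin
   exactly as the second changes sor, cyc and lmic1: inv and sor grow by
   n + 1 - i, rmin and cyc by [i = n + 1], lmin and lmic1 by [i = 1]. In both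
   cases the new set of left-to-right maxima positions consists of i and of the
   old positions smaller than i. Iterating gives a bijection that proves (2), and
   the same recursion gives the product formula.

   Foata's second fundamental transformation sends maj to inv, and it preserves
   the right-to-left minima and maxima because its step at a letter x keeps the
   relative order of the letters at most x and of the letters above x. This
   gives (17). The other statements follow through inversion, reversal and
   complementation. *)

(** * Insertion of the maximal value *)

Lemma card_set_sum (T : finType) (P : pred T) : #|[set x | P x]| = \sum_x P x.
Proof. by rewrite -sum1dep_card [LHS]big_mkcond; apply: eq_bigr => x _; case: (P x). Qed.

Lemma ninv_sum n (s : 'S_n) : ninv s = \sum_(i < n) \sum_(j < n) ((i < j) && (s j < s i)).
Proof.
by rewrite /ninv card_set_sum pair_big.
Qed.

Lemma sum_geq_ord n (m : nat) : \sum_(j < n) (m <= j) = n - m.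
Proof.
elim: n => [|n IH]; first by rewrite big_ord0.
by rewrite big_ord_recr /= IH; case: (leqP m n) => h /=; lia.
Qed.

Lemma lift_ltE n (i : 'I_n.+1) (a b : 'I_n) : (lift i a < lift i b) = (a < b).
Proof. by rewrite /= /bump; do 2 case: leqP => /=; lia. Qed.

Lemma forall_ord_lift n (i : 'I_n.+1) (P : pred 'I_n.+1) :
  [forall j, P j] = P i && [forall j : 'I_n, P (lift i j)].
Proof.
apply/forallP/andP => [h | [Pi /forallP h] j]; first by split=> //; apply/forallP.
by case: (unliftP i j) => [k ->|->].
Qed.

Lemma ltn_ord_max n (j : 'I_n.+1) : (@ord_max n < j) = false.
Proof. by rewrite ltnNge -ltnS ltn_ord. Qed.

Lemma ltn_lift_max n (a : 'I_n) : lift ord_max a < @ord_max n.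
Proof. by rewrite lift_max ltn_ord. Qed.

Definition is_lmax n (s : 'S_n) (i : 'I_n) := [forall j : 'I_n, (j < i) ==> (s j < s i)].

Section Insertion.
Variables (n : nat) (i : 'I_n.+1) (s : 'S_n).

Definition ins_max : 'S_n.+1 := lift_perm i ord_max s.

Lemma ins_max_id : ins_max i = ord_max. Proof. exact: lift_perm_id. Qed.
Lemma ins_max_lift (a : 'I_n) : ins_max (lift i a) = s a :> nat.
Proof. by rewrite /ins_max lift_perm_lift lift_max. Qed.

Lemma ninv_ins_max : ninv ins_max = ninv s + (n - i).
Proof.
rewrite !ninv_sum (bigD1_ord i) //= (bigD1_ord i) //= ltnn /= add0n addnC; congr (_ + _).
  apply: eq_bigr => a _; rewrite (bigD1_ord i) //= ins_max_id [X in _ && X]ltn_ord_max.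
  rewrite andbF add0n; apply: eq_bigr => b _.
  by rewrite !ins_max_lift -/(lift i a < lift i b) lift_ltE.
rewrite -(sum_geq_ord n i); apply: eq_bigr => a _.
rewrite ins_max_id ins_max_lift (ltn_ord (s a)) andbT /bump.
by congr (nat_of_bool _); case: leqP => /=; lia.
Qed.

Lemma rmin_ins_max : rmin ins_max = rmin s + (i == ord_max).
Proof.
rewrite /rmin !card_set_sum (bigD1_ord i) //= addnC; congr (_ + _).
  apply: eq_bigr => a _; rewrite (forall_ord_lift i) ins_max_id.
  rewrite ins_max_lift (ltn_ord (s a)) implybT.
  by congr (nat_of_bool _); apply: eq_forallb => b; rewrite lift_ltE ins_max_lift.
congr (nat_of_bool _); apply/forallP/eqP => [h|-> j]; last by rewrite ltnNge -ltnS ltn_ord.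
apply/val_inj/eqP; rewrite eqn_leq -ltnS ltn_ord leqNgt /=; apply/negP => lt_in.
by have := h ord_max; rewrite lt_in ins_max_id ltnNge -ltnS ltn_ord.
Qed.

Lemma lmin_ins_max : lmin ins_max = lmin s + (i == ord0).
Proof.
rewrite /lmin !card_set_sum (bigD1_ord i) //= addnC; congr (_ + _).
  apply: eq_bigr => a _; rewrite (forall_ord_lift i) ins_max_id.
  rewrite ins_max_lift (ltn_ord (s a)) implybT.
  by congr (nat_of_bool _); apply: eq_forallb => b; rewrite lift_ltE ins_max_lift.
congr (nat_of_bool _); apply/forallP/eqP => [h|-> j] //.
apply/val_inj/eqP; rewrite /= -leqn0 leqNgt; apply/negP => lt_in.
by have := h ord0; rewrite lt_in ins_max_id ltnNge -ltnS ltn_ord.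
Qed.

End Insertion.

(** The number of left-to-right maxima of [t] is not a function of [i] and [lmax s], so their
    positions are tracked. Both insertions satisfy this relation. *)
Definition lmax_update n (i : 'I_n.+1) (s : 'S_n) (t : 'S_n.+1) :=
  [/\ is_lmax t i, forall j : 'I_n.+1, i < j -> ~~ is_lmax t j
    & forall j : 'I_n, j < i -> is_lmax t (lift ord_max j) = is_lmax s j].

(** Being a left-to-right maximum depends only on the prefix, and [t] agrees with [s] before [i];
    the maximal value at [i] dominates everything after it. *)
Lemma lmax_updateP n (i : 'I_n.+1) (s : 'S_n) (t : 'S_n.+1) :
  t i = ord_max -> (forall j : 'I_n, j < i -> t (lift ord_max j) = s j :> nat) ->
  lmax_update i s t.
Proof.
move=> ti tj; split.
- apply/forallP => j; apply/implyP => lt_ji.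
  rewrite ti ltn_neqAle -ltnS ltn_ord andbT; apply: contraTneq lt_ji => e.
  have -> : j = i by apply: (@perm_inj _ t); rewrite ti; apply: val_inj.
  by rewrite ltnn.
- by move=> j lt_ij; apply/forallPn; exists i; rewrite lt_ij ti -leqNgt -ltnS ltn_ord.
move=> j lt_ji; rewrite /is_lmax (forall_ord_lift ord_max).
have -> : (@ord_max n < lift ord_max j) = false by rewrite ltnNge -ltnS ltn_ord.
apply: eq_forallb => k; rewrite !lift_max.
by case: ltnP => // lt_kj; rewrite !tj // (ltn_trans lt_kj).
Qed.

Lemma lmax_update_ins_max n (i : 'I_n.+1) (s : 'S_n) : lmax_update i s (ins_max i s).
Proof.
apply: lmax_updateP; first exact: ins_max_id.
move=> j lt_ji; rewrite -(ins_max_lift i s j); congr (val (ins_max i s _)).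
by apply: val_inj; rewrite /= /bump [i <= j]leqNgt [n <= j]leqNgt lt_ji ltn_ord.
Qed.

(** Lets two different insertions at the same position run in parallel and keep equal sets of
    left-to-right maxima positions. *)
Lemma lmax_update_eq n (i : 'I_n.+1) (s s' : 'S_n) (t t' : 'S_n.+1) :
  is_lmax s =1 is_lmax s' -> lmax_update i s t -> lmax_update i s' t' ->
  is_lmax t =1 is_lmax t'.
Proof.
move=> eq_s [ti gt_t lt_t] [t'i gt_t' lt_t'] j.
case: (ltngtP j i) => [lt_ji|lt_ij|/val_inj ->]; last by rewrite ti t'i.
  have lt_jn : j < n by rewrite (leq_trans lt_ji) // -ltnS.
  have -> : j = lift ord_max (Ordinal lt_jn) by apply: val_inj; apply/esym; exact: lift_max.
  by rewrite lt_t // lt_t' // eq_s.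
by rewrite (negbTE (gt_t _ lt_ij)) (negbTE (gt_t' _ lt_ij)).
Qed.

(** * Sorting *)

(* The last step of the sorting factorisation: the value at position i is
   replaced by the new maximum and moved to the end. *)
Section SortInsertion.
Variables (n : nat) (i : 'I_n.+1) (s : 'S_n).

Definition ext : 'S_n.+1 := lift_perm ord_max ord_max s.
Definition ins_sort : 'S_n.+1 := (tperm i ord_max * ext)%g.

Lemma ext_max : ext ord_max = ord_max. Proof. exact: lift_perm_id. Qed.
Lemma ext_lift (a : 'I_n) : ext (lift ord_max a) = lift ord_max (s a).
Proof. exact: lift_perm_lift. Qed.

Lemma ins_sort_id : ins_sort i = ord_max.
Proof. by rewrite /ins_sort permM tpermL ext_max. Qed.

Lemma lmax_update_ins_sort : lmax_update i s ins_sort.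
Proof.
apply: lmax_updateP; first exact: ins_sort_id.
move=> j lt_ji; rewrite /ins_sort permM tpermD ?ext_lift ?lift_max //.
  by rewrite -(inj_eq val_inj) [val (lift _ _)]lift_max neq_ltn lt_ji orbT.
exact: neq_lift.
Qed.

Lemma ins_sortV_max : (ins_sort^-1)%g ord_max = i.
Proof. by rewrite -ins_sort_id permK. Qed.

(** The backward walk of [s] makes a detour: a step into [i] now visits the new maximum first. *)
Lemma ins_sortV_lift (a : 'I_n) : (ins_sort^-1)%g (lift ord_max a) =
  if lift ord_max ((s^-1)%g a) == i then ord_max else lift ord_max ((s^-1)%g a).
Proof.
rewrite /ins_sort invMg tpermV permM /ext lift_permV lift_perm_lift.
case: eqVneq => [->|ne]; first by rewrite tpermL.
by rewrite tpermD 1?eq_sym // eq_sym neq_lift.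
Qed.

End SortInsertion.

Lemma ext_tperm n (a b : 'I_n) : ext (tperm a b) = tperm (lift ord_max a) (lift ord_max b).
Proof.
apply/permP => j; case: (unliftP ord_max j) => [k|] ->.
  by rewrite ext_lift inj_tperm //; apply: lift_inj.
by rewrite ext_max tpermD // eq_sym neq_lift.
Qed.

Lemma ext1 n : @ext n 1 = 1%g. Proof. exact: lift_perm1. Qed.
Lemma extM n (s t : 'S_n) : ext (s * t) = (ext s * ext t)%g.
Proof. by rewrite /ext lift_permM. Qed.
Lemma extX n (s : 'S_n) k : ext (s ^+ k) = (ext s ^+ k)%g.
Proof. by elim: k => [|k IH]; rewrite ?expg0 ?ext1 // !expgS extM IH. Qed.

(** * The sorting index under insertion *)

Lemma sorE n (s : 'S_n) w : sort_fact s w -> sor s = \sum_(t <- w) (t.2 - t.1).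
Proof. by move=> sw; rewrite /sor (sort_fact_uniq (xchooseP (sort_fact_ex s)) sw). Qed.

(** [ext] is a group morphism that sends transpositions to transpositions and keeps the values of
    the points. *)
Lemma sort_fact_ext n (s : 'S_n) w :
  sort_fact s w ->
  sort_fact (ext s) [seq (lift ord_max t.1, lift ord_max t.2) | t <- w].
Proof.
case/and3P => lt_w srt_w /eqP ->; apply/and3P; split.
- by rewrite all_map; apply: sub_all lt_w => t; rewrite -(lift_ltE ord_max).
- rewrite -map_comp (eq_map (g := fun t : 'I_n * 'I_n => val t.2)) // => t.
  exact: lift_max.
apply/eqP; rewrite -map_rev big_map (big_morph _ (@extM n) (@ext1 n)).
by apply: eq_bigr => t _; rewrite ext_tperm.
Qed.

Lemma sor_ins_sort n (i : 'I_n.+1) (s : 'S_n) : sor (ins_sort i s) = sor s + (n - i).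
Proof.
have sw := xchooseP (sort_fact_ex s); set w := xchoose _ in sw.
rewrite (sorE sw); have sw' := sort_fact_ext sw.
set w' := map _ _ in sw'.
have sumw' : \sum_(t <- w') (t.2 - t.1) = \sum_(t <- w) (t.2 - t.1).
  by rewrite big_map; apply: eq_bigr => t _; rewrite !lift_max.
(* If [i] is the last position, no transposition is added; otherwise [(i, ord_max)] closes the
   factorisation and contributes [n - i]. *)
case: (eqVneq i ord_max) => [->|ne_i].
  by rewrite /ins_sort tperm1 mul1g (sorE sw') sumw' subnn addn0.
have sw2 : sort_fact (ins_sort i s) (rcons w' (i, ord_max)).
  rewrite sort_fact_rcons /ins_sort mulgA tperm2 mul1g sw' andbT.
  rewrite ltn_neqAle val_eqE ne_i -ltnS ltn_ord /=.
  by rewrite all_map; apply/allP => t _; exact: ltn_lift_max.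
by rewrite (sorE sw2) -cats1 big_cat big_seq1 sumw'.
Qed.

(** * Cycles under insertion *)

Lemma porbit_ext_max n (s : 'S_n) : porbit (ext s) ord_max = [set ord_max].
Proof.
apply/setP => y; rewrite inE.
apply/porbitP/eqP => [[k ->]|->]; last by exists 0; rewrite expg0 perm1.
by rewrite -extX ext_max.
Qed.

Lemma porbit_ext_lift n (s : 'S_n) (a : 'I_n) :
  porbit (ext s) (lift ord_max a) = lift ord_max @: porbit s a.
Proof.
apply/setP => y; apply/porbitP/imsetP => [[k ->]|[b /porbitP[k ->] ->]].
  by exists ((s ^+ k)%g a); [apply/porbitP; exists k | rewrite -extX ext_lift].
by exists k; rewrite -extX ext_lift.
Qed.

Lemma cyc_ext n (s : 'S_n) : cyc (ext s) = (cyc s).+1.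
Proof.
have -> : cyc (ext s) = #|[set ord_max] |: [set lift ord_max @: A | A : {set 'I_n} in porbits s]|.
  congr #|pred_of_set _|; apply/setP => A; rewrite inE in_set1.
  apply/imsetP/orP => [[y _ ->]|[/eqP ->|/imsetP[B /imsetP[a _ ->] ->]]].
  - case: (unliftP ord_max y) => [a|] ->; last by left; rewrite porbit_ext_max.
    by right; rewrite porbit_ext_lift; do 2 apply: imset_f.
  - by exists ord_max => //; rewrite porbit_ext_max.
  - by exists (lift ord_max a) => //; rewrite porbit_ext_lift.
rewrite cardsU1 card_imset; last exact/imset_inj/lift_inj.
case: imsetP => // -[B _ /setP/(_ ord_max)].
rewrite inE eqxx => /esym/imsetP[a _ e].
by have := neq_lift ord_max a; rewrite -e eqxx.
Qed.

Lemma cyc_ins_sort n (i : 'I_n.+1) (s : 'S_n) :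
  cyc (ins_sort i s) = cyc s + (i == ord_max).
Proof.
(* For [i] different from [ord_max], the transposition merges the fixed point [ord_max] into the
   cycle of [i] and so cancels the extra cycle of [ext s]. *)
have := porbits_mul_tperm (ext s) i ord_max.
rewrite /= porbit_ext_max in_set1 -!/(cyc _) cyc_ext -/(ins_sort i s).
by case: (i == ord_max) => /=; lia.
Qed.

(** The B-code as the end of a walk rather than through a minimal exponent: inserting a new maximum
    lengthens the walk, hence changes the exponent, but not the end point. *)
Inductive first_return (n : nat) (f : 'I_n -> 'I_n) (i : 'I_n) : 'I_n -> 'I_n -> Prop :=
| ReturnNow y : f y <= i -> first_return f i y (f y)
| ReturnLater y b : i < f y -> first_return f i (f y) b -> first_return f i y b.

Lemma first_return_uniq n (f : 'I_n -> 'I_n) i y b c :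
  first_return f i y b -> first_return f i y c -> b = c.
Proof.
move=> yb; elim: yb c => {y b} [y le_y|y b lt_y _ IH] c yc.
  by case: yc le_y => // z d lt_z _; rewrite leqNgt lt_z.
by apply: IH; case: yc lt_y => // z le_z; rewrite ltnNge le_z.
Qed.

Lemma first_return_Bcode n (s : 'S_n) i : first_return (s^-1)%g i i (Bcode s i).
Proof.
rewrite /Bcode; case: ex_minnP => k /andP[k_gt0 le_k min_k].
have expVE m : (s ^- m)%g i = iter m (s^-1)%g i by rewrite -expgVn permX.
rewrite expVE in le_k *.
suff gen m : m < k -> first_return (s^-1)%g i (iter m (s^-1)%g i) (iter k (s^-1)%g i).
  exact: (gen 0).
(* Induction on the number of steps left; minimality of [k] excludes an earlier return. *)
move def_d: (k - m) => d; elim: d m def_d => [|d IH] m def_d lt_mk; first by lia.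
case: (ltnP m.+1 k) => [lt_m1|ge_m1]; last first.
  have -> : k = m.+1 by lia.
  by rewrite iterS; constructor; rewrite -iterS; have -> : m.+1 = k by lia.
constructor; last by rewrite -iterS; apply: IH; lia.
rewrite -iterS ltnNge; apply/negP => le_m1.
by have := min_k m.+1; rewrite expVE le_m1 /= => /(_ isT); lia.
Qed.

(** The detour visits [ord_max], which exceeds [lift ord_max j] and cannot end the walk; the next
    point is the one that followed in the old walk. *)
Lemma first_return_ins_sort n (i : 'I_n.+1) (s : 'S_n) j y b :
  first_return (s^-1)%g j y b ->
  first_return ((ins_sort i s)^-1)%g (lift ord_max j) (lift ord_max y) (lift ord_max b).
Proof.
elim=> {y b} [y le_y|y b lt_y _ IH].
  have := ins_sortV_lift i s y; case: eqVneq => [e|ne] e2.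
    apply: ReturnLater; rewrite e2 ?ltn_lift_max // e.
    rewrite -[X in first_return _ _ _ X](ins_sortV_max i s).
    by constructor; rewrite ins_sortV_max -e !lift_max.
  by rewrite -e2; constructor; rewrite e2 !lift_max.
have := ins_sortV_lift i s y; case: eqVneq => [e|ne] e2;
  apply: ReturnLater; rewrite e2 ?ltn_lift_max //.
- apply: ReturnLater; rewrite ins_sortV_max; first by rewrite -e !lift_max.
  by rewrite -[X in first_return _ _ X]e.
- by rewrite !lift_max.
Qed.

Lemma lmic1_ins_sort n (i : 'I_n.+1) (s : 'S_n) :
  lmic1 (ins_sort i s) = lmic1 s + (i == ord0).
Proof.
rewrite /lmic1 !card_set_sum (bigD1_ord ord_max) //= addnC; congr (_ + _).
  apply: eq_bigr => a _.
  have -> : Bcode (ins_sort i s) (lift ord_max a) = lift ord_max (Bcode s a).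
    apply: first_return_uniq (first_return_Bcode _ _) _.
    exact/first_return_ins_sort/first_return_Bcode.
  by rewrite lift_max.
(* From [ord_max] the walk ends after one step, since every point is at most [ord_max]. *)
have -> // : Bcode (ins_sort i s) ord_max = i.
apply: first_return_uniq (first_return_Bcode _ _) _.
rewrite -[X in first_return _ _ _ X](ins_sortV_max i s); constructor.
by rewrite -ltnS ltn_ord.
Qed.

(** * Both insertions as bijections, and the transfer between them *)

Lemma insertion_bij n (ins : 'I_n.+1 -> 'S_n -> 'S_n.+1) :
  (forall i s, ins i s i = ord_max) -> (forall i, injective (ins i)) ->
  bijective (fun p : 'I_n.+1 * 'S_n => ins p.1 p.2).
Proof.
(* The position of the maximum recovers [i], then [s] follows; surjectivity comes from the count
   [(n+1)! = (n+1) n!]. *)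
move=> ins_id ins_inj; apply: inj_card_bij => [[i s] [j t] /= e|].
  have eij : i = j by apply: (@perm_inj _ (ins i s)); rewrite ins_id e ins_id.
  by move: e; rewrite eij => /ins_inj ->.
by rewrite card_prod !card_Sn card_ord factS.
Qed.

Lemma ins_max_bij n : bijective (fun p : 'I_n.+1 * 'S_n => ins_max p.1 p.2).
Proof.
apply: insertion_bij => [|i s t e]; first exact: ins_max_id.
by apply/permP => a; apply: val_inj; rewrite /= -!(ins_max_lift i) e.
Qed.

Lemma ins_sort_bij n : bijective (fun p : 'I_n.+1 * 'S_n => ins_sort p.1 p.2).
Proof.
apply: insertion_bij => [|i s t /mulgI e]; first exact: ins_sort_id.
by apply/permP => a; apply: (@lift_inj _ ord_max); rewrite -!ext_lift e.
Qed.

Lemma sort_to_inv n : exists2 f : 'S_n -> 'S_n, injective f &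
  forall s, [/\ ninv (f s) = sor s, rmin (f s) = cyc s, lmin (f s) = lmic1 s
              & is_lmax (f s) =1 is_lmax s].
Proof.
elim: n => [|n [f f_inj fP]].
  exists id => // s; split=> //.
  - rewrite ninv_sum big_ord0 (@sorE _ s [::]) ?big_nil //.
    by rewrite /sort_fact big_nil; apply/eqP/permP => -[].
  - by rewrite /rmin card_set_sum big_ord0 /cyc; apply/esym/eq_card0 => A; apply/imsetP => -[[]].
  - by rewrite /lmin /lmic1 !card_set_sum !big_ord0.
have [g gK Kg] := ins_sort_bij n.
(* Decode [t] by the sorting insertion, transform the smaller permutation, and insert the maximum at
   the same position. *)
exists (fun t => ins_max (g t).1 (f (g t).2)) => [t u|t].
  move/(bij_inj (ins_max_bij n) (x1 := ((g t).1, _)) (x2 := ((g u).1, _))) => -[e1 /f_inj e2].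
  by apply: (can_inj Kg); case: (g t) (g u) e1 e2 => a b [c d] /= -> ->.
case def_g: (g t) => [i s] /=; have {def_g} <- : ins_sort i s = t by rewrite -[RHS]Kg def_g.
have [e1 e2 e3 e4] := fP s.
rewrite ninv_ins_max rmin_ins_max lmin_ins_max sor_ins_sort cyc_ins_sort lmic1_ins_sort e1 e2 e3.
split=> //.
exact: lmax_update_eq e4 (lmax_update_ins_max _ _) (lmax_update_ins_sort _ _).
Qed.

(** * Foata's second fundamental transformation *)

Section BlockRotation.
Variables (T : eqType) (p : pred T).

(* Cuts the word after each letter in p and moves that letter to the front of
   its block; acc is the part of the current block read so far. *)
Fixpoint block_rot (acc w : seq T) : seq T :=
  if w is a :: w' then
    if p a then a :: acc ++ block_rot [::] w' else block_rot (rcons acc a) w'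
  else acc.

(** No unfinished block remains at the end; the default [true] admits the empty word. *)
Definition ends_in (w : seq T) := last true (map p w).

Lemma block_rot_cat acc u a w : all (predC p) u -> p a ->
  block_rot acc (u ++ a :: w) = a :: (acc ++ u) ++ block_rot [::] w.
Proof.
move=> + pa; elim: u acc => [|b u IH] acc /=; first by rewrite pa cats0.
by case/andP => /negbTE -> /IH ->; rewrite cat_rcons.
Qed.

Lemma block_split w : ends_in w -> w != [::] ->
  exists u a w', [/\ w = u ++ a :: w', all (predC p) u, p a & ends_in w'].
Proof.
elim: w => [|b w IH] // end_bw _; case pb: (p b).
  by exists [::], b, w; split=> //; move: end_bw; rewrite /ends_in /= pb.
case: w => [|c w] in IH end_bw *; first by move: end_bw; rewrite /ends_in /= pb.
have [|//|u [a [w' [-> au pa end_w']]]] := IH; first by [].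
by exists (b :: u), a, w'; split; rewrite //= pb.
Qed.

(** Induction block by block: [u ++ [:: a]] is the first block, [w] the rest and [v] its
    rotation. *)
Lemma block_rot_ind (P : seq T -> seq T -> Prop) :
  P [::] [::] ->
  (forall u a w v, all (predC p) u -> p a -> P w v -> P (u ++ a :: w) (a :: u ++ v)) ->
  forall w, ends_in w -> P w (block_rot [::] w).
Proof.
move=> P0 Pblock w; move: {2}(size w) (leqnn (size w)) => m.
elim: m w => [|m IH] w; first by rewrite leqn0 size_eq0 => /eqP ->.
case: (eqVneq w [::]) => [-> //|w_neq0] le_w end_w.
have [u [a [w' [ew au pa end_w']]]] := block_split end_w w_neq0.
rewrite ew block_rot_cat //; apply: Pblock => //; apply: IH => //.
by move: le_w; rewrite ew size_cat /=; lia.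
Qed.

Lemma perm_block_rot w : ends_in w -> perm_eq (block_rot [::] w) w.
Proof.
move: w; apply: (block_rot_ind (P := fun w v => perm_eq v w)) => // u a w v _ _ pwv.
by rewrite -cat1s perm_catCA perm_cat2l perm_cons.
Qed.

(** A rotation only moves a letter in [p] past letters outside [p], so each class keeps its
    order. *)
Lemma filter_block_rot w : ends_in w ->
  filter p (block_rot [::] w) = filter p w /\
  filter (predC p) (block_rot [::] w) = filter (predC p) w.
Proof.
move: w; apply: (block_rot_ind (P := fun w v => filter p v = filter p w /\
  filter (predC p) v = filter (predC p) w)) => // u a w v au pa [e1 e2].
have pu0 : filter p u = [::].
  by apply/eqP; rewrite -[_ == _]negbK -has_filter -all_predC.
by rewrite /= !filter_cat /= pa /= e1 e2 pu0.
Qed.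

(** Every rotated block starts with a letter in [p], so block boundaries can be read off the image;
    [take 1] covers the empty word. *)
Lemma block_rot_head w : ends_in w -> all p (take 1 (block_rot [::] w)).
Proof.
move: w; apply: (block_rot_ind (P := fun w v => all p (take 1 v))) => // u a w v _ pa _.
by rewrite /= pa take0.
Qed.

Lemma cat_prefix_inj (u u' v v' : seq T) :
  all (predC p) u -> all (predC p) u' -> all p (take 1 v) -> all p (take 1 v') ->
  u ++ v = u' ++ v' -> u = u' /\ v = v'.
Proof.
elim: u u' => [|a u IH] [|a' u'] //=.
- by move=> _ /andP[/negbTE na _] + _ e; rewrite e /= na.
- by move=> /andP[/negbTE na _] _ _ + e; rewrite -e /= na.
by move=> /andP[_ au] /andP[_ au'] pv pv' [-> /(IH _ au au' pv pv')[-> ->]].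
Qed.

(** The first block of the image is its head followed by the longest run of letters outside [p];
    decoding continues on the remainder. *)
Lemma block_rot_inj w1 w2 : ends_in w1 -> ends_in w2 ->
  block_rot [::] w1 = block_rot [::] w2 -> w1 = w2.
Proof.
move: {2}(size w1) (leqnn (size w1)) => m.
elim: m w1 w2 => [|m IH] w1 w2.
  rewrite leqn0 size_eq0 => /eqP -> _ end2 /= e.
  by have := perm_block_rot end2; rewrite -e perm_sym => /perm_nilP ->.
move=> le_w1 end1 end2 e.
case: (eqVneq w1 [::]) => [e1|n1].
  by have := perm_block_rot end2; rewrite -e e1 perm_sym => /perm_nilP ->.
case: (eqVneq w2 [::]) => [e2|n2].
  by have := perm_block_rot end1; rewrite e e2 perm_sym => /perm_nilP ->.
have [u1 [a1 [v1 [ew1 au1 pa1 endv1]]]] := block_split end1 n1.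
have [u2 [a2 [v2 [ew2 au2 pa2 endv2]]]] := block_split end2 n2.
move: e; rewrite ew1 ew2 !block_rot_cat //= => -[-> e].
have [-> e'] := cat_prefix_inj au1 au2 (block_rot_head endv1) (block_rot_head endv2) e.
rewrite (IH v1 v2) //.
by move: le_w1; rewrite ew1 size_cat /=; lia.
Qed.

End BlockRotation.

(** * Inversions, major index and Foata's map on words *)

Section WordStatistics.
Implicit Types (w v u : seq nat) (x a : nat).

Fixpoint winv w : nat :=
  if w is a :: w' then count (fun b => b < a) w' + winv w' else 0.

Definition cross_inv w v := \sum_(a <- w) count (fun b => b < a) v.

Lemma winv_cat w v : winv (w ++ v) = winv w + winv v + cross_inv w v.
Proof.
rewrite /cross_inv; elim: w => [|a w IH] /=; first by rewrite big_nil addn0.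
by rewrite big_cons count_cat IH; lia.
Qed.

Lemma cross_inv_perm w v v' : perm_eq v v' -> cross_inv w v = cross_inv w v'.
Proof. by move=> /seq.permP e; apply: eq_bigr => a _; rewrite e. Qed.

Lemma cross_inv_gt w a : all (fun b => a < b) w -> cross_inv w [:: a] = size w.
Proof.
rewrite /cross_inv; elim: w => [|b w IH] /=; first by rewrite big_nil.
by case/andP => lt_ab /IH e; rewrite big_cons /= lt_ab e.
Qed.

Lemma cross_inv_cons w a v : cross_inv w (a :: v) = cross_inv w [:: a] + cross_inv w v.
Proof. by rewrite /cross_inv -big_split; apply: eq_bigr => b _ /=; lia. Qed.

Lemma cross_inv_lt w a : all (fun b => b < a) w -> cross_inv w [:: a] = 0.
Proof.
rewrite /cross_inv; elim: w => [|b w IH] /=; first by rewrite big_nil.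
by case/andP => lt_ba /IH e; rewrite big_cons /= e ltnNge ltnW.
Qed.

Lemma winv_rcons w x : winv (rcons w x) = winv w + count (fun b => x < b) w.
Proof.
rewrite -cats1 winv_cat /= !addn0; congr (_ + _); rewrite /cross_inv.
by elim: w => [|a w IH]; rewrite ?big_nil //= big_cons IH /= addn0.
Qed.

(** Moving [a] in front of the larger letters [u] removes [size u] inversions; over all blocks this
    counts the letters outside [p]. *)
Lemma winv_block_rot_low (p : pred nat) w :
  (forall a b, p a -> ~~ p b -> a < b) -> ends_in p w ->
  winv (block_rot p [::] w) + count (predC p) w = winv w.
Proof.
move=> lt_p end_w.
(* The permutation is carried along because inversions between [u] and the rest depend only on the
   multiset of letters of the rest. *)
suff [] : perm_eq (block_rot p [::] w) w /\
          winv (block_rot p [::] w) + count (predC p) w = winv w by [].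
move: w end_w; apply: (block_rot_ind (P := fun w v => perm_eq v w /\
  winv v + count (predC p) w = winv w)) => // u a w v au pa [pvw e].
split; first by rewrite -cat1s perm_catCA perm_cat2l perm_cons.
have lt_au : all (fun b => a < b) u by apply: sub_all au => b; apply: lt_p.
rewrite /= !winv_cat /= !count_cat /= pa cross_inv_cons (cross_inv_gt lt_au).
rewrite (cross_inv_perm u pvw) -e (seq.permP pvw).
have -> : count (fun b => b < a) u = 0.
  apply/eqP; rewrite -leqn0 leqNgt -has_count; apply/hasPn => b /(allP lt_au).
  by rewrite -leqNgt => /ltnW.
have -> : count (predC p) u = size u by apply/eqP; rewrite -all_count.
rewrite /=; lia.
Qed.

Lemma winv_block_rot_high (p : pred nat) w :
  (forall a b, p a -> ~~ p b -> b < a) -> ends_in p w ->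
  winv (block_rot p [::] w) = winv w + count (predC p) w.
Proof.
move=> lt_p end_w.
suff [] : perm_eq (block_rot p [::] w) w /\
          winv (block_rot p [::] w) = winv w + count (predC p) w by [].
move: w end_w; apply: (block_rot_ind (P := fun w v => perm_eq v w /\
  winv v = winv w + count (predC p) w)) => // u a w v au pa [pvw e].
split; first by rewrite -cat1s perm_catCA perm_cat2l perm_cons.
have lt_ua : all (fun b => b < a) u by apply: sub_all au => b; apply: lt_p.
rewrite /= !winv_cat /= !count_cat /= pa cross_inv_cons (cross_inv_lt lt_ua).
rewrite (cross_inv_perm u pvw) e (seq.permP pvw).
have -> : count (fun b => b < a) u = size u by apply/eqP; rewrite -all_count.
have -> : count (predC p) u = size u by apply/eqP; rewrite -all_count.
rewrite /=; lia.
Qed.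

Definition wmaj w : nat :=
  \sum_(i < (size w).-1) if nth 0 w i.+1 < nth 0 w i then i.+1 else 0.

Lemma wmaj_rcons w x :
  wmaj (rcons w x) = wmaj w + (if last x w <= x then 0 else size w).
Proof.
(* For the empty word the default of [last] is [x] itself, so no descent is counted. *)
case/lastP: w => [|w y]; first by rewrite /wmaj !big_ord0 leqnn.
rewrite /wmaj !size_rcons /= big_ord_recr /= last_rcons; congr (_ + _).
  apply: eq_bigr => i _; have := ltn_ord i.
  by rewrite !nth_rcons !size_rcons => lt_i; rewrite !ltnS lt_i (ltnW lt_i).
by rewrite !nth_rcons !size_rcons ltnSn !ltnn !eqxx ltnNge; case: leqP.
Qed.

(** The right-to-left records for [r]: minima for [leq], maxima for the converse strict order. *)
Fixpoint rtl (r : rel nat) w : seq nat :=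
  if w is a :: w' then if all (r a) w' then a :: rtl r w' else rtl r w' else [::].

Lemma rtl_rcons (r : rel nat) w x :
  rtl r (rcons w x) = rcons [seq a <- rtl r w | r a x] x.
Proof.
elim: w => //= a w IH; rewrite all_rcons IH; case: (all (r a) w) => /=.
  by rewrite andbT; case: (r a x).
by rewrite andbF.
Qed.

(** Under the hypothesis, a letter that fails [r _ x] never obstructs a record that satisfies it, so
    it can be removed beforehand. *)
Lemma filter_rtl (r : rel nat) w x :
  (forall a b, r a x -> ~~ r b x -> r a b) ->
  [seq a <- rtl r w | r a x] = rtl r [seq a <- w | r a x].
Proof.
move=> rP; elim: w => //= a w IH; case ax: (r a x) => /=; last first.
  by case: (all _ w) => //=; rewrite ax.
rewrite all_filter [all _ w in RHS](eq_in_all (a2 := r a)).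
  by rewrite -IH; case: (all (r a) w); rewrite /= ?ax.
by move=> b _ /=; case bx: (r b x) => //=; rewrite rP ?bx.
Qed.

(** The last letter decides which class closes the blocks, so that the word always ends with a
    complete block. *)
Definition foata_step x w : seq nat :=
  if last x w <= x then block_rot (fun a => a <= x) [::] w
  else block_rot (fun a => x < a) [::] w.

Definition foata w : seq nat := foldl (fun v x => rcons (foata_step x v) x) [::] w.

Lemma foata_rcons w x : foata (rcons w x) = rcons (foata_step x (foata w)) x.
Proof. by rewrite /foata foldl_rcons. Qed.

Lemma ends_in_low x w : last x w <= x -> ends_in (fun a => a <= x) w.
Proof. by case/lastP: w => // w a; rewrite last_rcons /ends_in map_rcons last_rcons. Qed.

Lemma ends_in_high x w : x < last x w -> ends_in (fun a => x < a) w.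
Proof. by case/lastP: w => // w a; rewrite last_rcons /ends_in map_rcons last_rcons. Qed.

Lemma perm_foata_step x w : perm_eq (foata_step x w) w.
Proof.
rewrite /foata_step; case: leqP => h; apply: perm_block_rot.
  exact: ends_in_low.
exact: ends_in_high.
Qed.

Lemma filter_foata_step x w :
  [seq a <- foata_step x w | a <= x] = [seq a <- w | a <= x] /\
  [seq a <- foata_step x w | x < a] = [seq a <- w | x < a].
Proof.
rewrite /foata_step; case: leqP => h.
  have [e1 e2] := filter_block_rot (ends_in_low h); split=> //.
  by under eq_filter do rewrite ltnNge; under [RHS]eq_filter do rewrite ltnNge.
have [e1 e2] := filter_block_rot (ends_in_high h); split=> //.
by under eq_filter do rewrite leqNgt; under [RHS]eq_filter do rewrite leqNgt.
Qed.

(** The first letter of the image reveals the case used: it is at most [x] in the low case and above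
    [x] in the high case. *)
Lemma foata_step_inj x : injective (foata_step x).
Proof.
move=> w1 w2; rewrite /foata_step.
case: leqP => h1; case: leqP => h2 e.
- exact: block_rot_inj (ends_in_low h1) (ends_in_low h2) e.
- have := block_rot_head (ends_in_low h1); have := block_rot_head (ends_in_high h2).
  have := perm_block_rot (ends_in_high h2); rewrite e.
  case: (block_rot _ _ _) => [|a v] p2 /=; last by case: ltnP.
  by move: p2 h2; rewrite perm_sym => /perm_nilP -> /=; rewrite ltnn.
- have := block_rot_head (ends_in_low h2); have := block_rot_head (ends_in_high h1).
  have := perm_block_rot (ends_in_high h1); rewrite -e.
  case: (block_rot _ _ _) => [|a v] p1 /=; last by case: ltnP.
  by move: p1 h1; rewrite perm_sym => /perm_nilP -> /=; rewrite ltnn.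
exact: block_rot_inj (ends_in_high h1) (ends_in_high h2) e.
Qed.

(** In the low case the rotation loses one inversion per letter above [x], and appending [x]
    restores them. In the high case it gains one per letter at most [x], and [x] adds one per letter
    above it, [size w] in all. *)
Lemma winv_foata_step x w :
  winv (rcons (foata_step x w) x) = winv w + (if last x w <= x then 0 else size w).
Proof.
rewrite winv_rcons (seq.permP (perm_foata_step x w)) /foata_step; case: leqP => h.
  rewrite addn0 -[RHS](winv_block_rot_low (p := fun a => a <= x)) //.
  - by congr (_ + _); apply: eq_count => a /=; rewrite ltnNge.
  - by move=> a b le_a; rewrite -ltnNge; apply: leq_ltn_trans.
  - exact: ends_in_low.
rewrite (winv_block_rot_high (p := fun a => x < a)).
- by rewrite -(count_predC (fun a => x < a) w) -addnA; congr (_ + _); apply: addnC.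
- by move=> a b lt_a; rewrite -leqNgt => le_b; apply: leq_ltn_trans lt_a.
- exact: ends_in_high.
Qed.

Lemma perm_foata w : perm_eq (foata w) w.
Proof.
elim/last_ind: w => // w x IH; rewrite foata_rcons -!cats1 perm_cat2r.
exact: perm_trans (perm_foata_step _ _) IH.
Qed.

Lemma foata_inj : injective foata.
Proof.
move=> w1; elim/last_ind: w1 => [|w1 x1 IH] w2 e.
  by have := perm_foata w2; rewrite -e perm_sym => /perm_nilP.
case/lastP: w2 e => [|w2 x2]; first by move/(congr1 size); rewrite foata_rcons size_rcons.
by rewrite !foata_rcons => /rcons_inj[e ex]; move: e; rewrite ex => /foata_step_inj/IH ->.
Qed.

(** Makes the descent test performed on [foata w] agree with the one on [w]. *)
Lemma last_foata x w : last x (foata w) = last x w.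
Proof. by case/lastP: w => // w a; rewrite foata_rcons !last_rcons. Qed.

Lemma winv_foata w : winv (foata w) = wmaj w.
Proof.
elim/last_ind: w => [|w x IH]; first by rewrite /wmaj big_ord0.
by rewrite foata_rcons winv_foata_step wmaj_rcons IH last_foata (perm_size (perm_foata w)).
Qed.

(* A letter left of x stays a right-to-left minimum only if it is at most x, and
   a foata_step at x does not reorder the letters at most x. *)
Lemma rtl_leq_foata w : rtl leq (foata w) = rtl leq w.
Proof.
elim/last_ind: w => // w x IH; rewrite foata_rcons !rtl_rcons.
have trP a b : a <= x -> ~~ (b <= x) -> a <= b.
  by rewrite -ltnNge => le_a /ltnW; apply: leq_trans.
rewrite filter_rtl // (filter_foata_step x (foata w)).1 -filter_rtl // IH //.
Qed.

Lemma rtl_gtn_foata w : rtl (fun a b => b < a) (foata w) = rtl (fun a b => b < a) w.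
Proof.
elim/last_ind: w => // w x IH; rewrite foata_rcons !rtl_rcons.
have trP a b : x < a -> ~~ (x < b) -> b < a.
  by rewrite -leqNgt => lt_a le_b; apply: leq_ltn_trans lt_a.
rewrite filter_rtl // (filter_foata_step x (foata w)).2 -filter_rtl // IH //.
Qed.

End WordStatistics.

(** * Permutations as words *)

Definition fword n (f : 'I_n -> nat) : seq nat := [seq f i | i <- enum 'I_n].

(** Removing the first letter of a permutation need not leave a permutation, hence words of
    arbitrary functions. *)
Lemma fwordS n (f : 'I_n.+1 -> nat) : fword f = f ord0 :: fword (fun i => f (lift ord0 i)).
Proof. by rewrite /fword enum_ordSl /= -map_comp. Qed.

Lemma count_fword n (f : 'I_n -> nat) (P : pred nat) :
  count P (fword f) = \sum_(i < n) P (f i).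
Proof.
rewrite /fword count_map -sum1_count big_enum_cond /= big_mkcond.
by apply: eq_bigr => i _ /=; case: (P _).
Qed.

Lemma winv_fword n (f : 'I_n -> nat) :
  winv (fword f) = \sum_(i < n) \sum_(j < n) ((i < j) && (f j < f i)).
Proof.
elim: n f => [|n IH] f; first by rewrite big_ord0 /fword enum_ord0.
rewrite fwordS big_ord_recl /= big_ord_recl /= add0n IH count_fword; congr (_ + _).
apply: eq_bigr => i _; rewrite big_ord_recl /= add0n.
by apply: eq_bigr => j _.
Qed.

Lemma size_rtl_fword n (f : 'I_n -> nat) (r : rel nat) :
  size (rtl r (fword f)) = #|[set i : 'I_n | [forall j : 'I_n, (i < j) ==> r (f i) (f j)]]|.
Proof.
rewrite card_set_sum; elim: n f => [|n IH] f; first by rewrite big_ord0 /fword enum_ord0.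
rewrite fwordS big_ord_recl /= fun_if /= IH.
have -> : all (r (f ord0)) (fword (fun i => f (lift ord0 i))) =
    [forall j : 'I_n.+1, (0 < j) ==> r (f ord0) (f j)].
  rewrite (forall_ord_lift ord0) /=; apply/allP/forallP => [h i|h x /mapP[i _ ->]].
    by apply: h; apply: map_f; rewrite mem_enum.
  exact: h.
rewrite [X in _ = _ + X](eq_bigr (fun i : 'I_n => nat_of_bool
    [forall j : 'I_n, (i < j) ==> r (f (lift ord0 i)) (f (lift ord0 j))])).
  by case: [forall j : 'I_n.+1, _].
by move=> i _; rewrite (forall_ord_lift ord0).
Qed.

Definition word n (s : 'S_n) : seq nat := fword (fun i => s i).

Lemma size_word n (s : 'S_n) : size (word s) = n.
Proof. by rewrite size_map size_enum_ord. Qed.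

Lemma nth_word n (s : 'S_n) (i : 'I_n) : nth 0 (word s) i = s i.
Proof. by rewrite (nth_map i) ?size_enum_ord // nth_ord_enum. Qed.

Lemma word_inj n : injective (@word n).
Proof. by move=> s t e; apply/permP => i; apply: val_inj; rewrite /= -!nth_word e. Qed.

Lemma perm_word n (s : 'S_n) : perm_eq (word s) (iota 0 n).
Proof.
rewrite -val_enum_ord /word /fword (map_comp val s); apply: perm_map; apply: uniq_perm.
- by rewrite map_inj_uniq ?enum_uniq //; apply: perm_inj.
- exact: enum_uniq.
by move=> i; rewrite mem_enum -[i](permKV s) map_f // mem_enum.
Qed.

Lemma wordP n (w : seq nat) : perm_eq w (iota 0 n) -> exists s : 'S_n, word s = w.
Proof.
move=> pw; have sz : size w = n by rewrite (perm_size pw) size_iota.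
have lt_w i : i < n -> nth 0 w i < n.
  move=> lt_i; have := mem_nth 0 (s := w) (n := i).
  by rewrite sz lt_i (perm_mem pw) mem_iota => /(_ isT).
pose f (i : 'I_n) := Ordinal (lt_w i (ltn_ord i)).
have f_inj : injective f.
  move=> i j /(congr1 val)/eqP /=.
  by rewrite nth_uniq ?sz ?ltn_ord // ?(perm_uniq pw) ?iota_uniq // => /eqP/val_inj.
exists (perm f_inj); apply: (@eq_from_nth _ 0); rewrite size_word // => i lt_i.
by rewrite -[i]/(val (Ordinal lt_i)) nth_word permE.
Qed.

Lemma ninv_word n (s : 'S_n) : ninv s = winv (word s).
Proof. by rewrite ninv_sum winv_fword. Qed.

(** The weak order [leq] suffices because the letters are distinct. *)
Lemma rmin_word n (s : 'S_n) : rmin s = size (rtl leq (word s)).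
Proof.
rewrite /word size_rtl_fword; apply: eq_card => i; rewrite !inE.
apply: eq_forallb => j; case: ltnP => //= lt_ij.
by rewrite ltn_neqAle val_eqE (inj_eq perm_inj) -val_eqE neq_ltn lt_ij.
Qed.

Lemma rmax_word n (s : 'S_n) : rmax s = size (rtl (fun a b => b < a) (word s)).
Proof. by rewrite /word size_rtl_fword. Qed.

(** A double sum over pairs of positions can be reindexed and transposed; each row has at most one
    nonzero term. *)
Lemma sum_Des n (s : 'S_n) (F : 'I_n -> nat) :
  \sum_(i in Des s) F i =
  \sum_(i < n) \sum_(j < n) if (j == i.+1 :> nat) && (s j < s i) then F i else 0.
Proof.
rewrite big_mkcond; apply: eq_bigr => i _; rewrite inE.
case: existsP => [[j /andP[/eqP ej lt_j]]|no_j].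
  rewrite (bigD1 j) //= ej eqxx lt_j big1 ?addn0 // => k ne_k.
  case: eqP => //= ek; case/eqP: ne_k; apply: val_inj; rewrite /= ek ej //.
by rewrite big1 // => j _; case: ifP => // h; case: no_j; exists j.
Qed.

Lemma maj_word n (s : 'S_n) : maj s = wmaj (word s).
Proof.
rewrite /maj sum_Des /wmaj size_word; case: n s => [|n] s; first by rewrite !big_ord0.
(* The last position has no successor, so its term vanishes. *)
rewrite big_ord_recr /= [X in _ + X]big1 ?addn0; last first.
  by move=> j _; rewrite ltn_eqF ?ltn_ord.
apply: eq_bigr => i _; have lt_i : i.+1 < n.+1 by rewrite ltnS.
rewrite (bigD1 (Ordinal lt_i)) //= eqxx /= big1 ?addn0.
  rewrite -[i.+1 in RHS]/(val (Ordinal lt_i)) nth_word.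
  by rewrite -[nat_of_ord i in RHS]/(val (widen_ord (leqnSn n) i)) nth_word.
move=> j ne_j; case: eqP => //= ej; case/eqP: ne_j; exact: val_inj.
Qed.

Lemma maj_to_inv n : exists2 f : 'S_n -> 'S_n, injective f &
  forall s, [/\ ninv (f s) = maj s, rmin (f s) = rmin s & rmax (f s) = rmax s].
Proof.
have ex (s : 'S_n) : exists t : 'S_n, word t == foata (word s).
  have [t <-] := wordP (perm_trans (perm_foata (word s)) (perm_word s)).
  by exists t.
have fP s := eqP (xchooseP (ex s)).
exists (fun s => xchoose (ex s)) => [s t /(congr1 (@word n))|s].
  by rewrite !fP => /foata_inj/word_inj.
by rewrite ninv_word !rmin_word !rmax_word fP winv_foata rtl_leq_foata rtl_gtn_foata maj_word.
Qed.

(** * Equidistribution and the product formula *)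

Section Equidistribution.
Variable n : nat.

(** Equidistribution as equality of multisets of values, from which postcomposition and summation
    follow. *)
Lemma equidistributedP (T : eqType) (f g : 'S_n -> T) :
  equidistributed f g <-> perm_eq (map f (enum 'S_n)) (map g (enum 'S_n)).
Proof.
have countE (h : 'S_n -> T) v : count_mem v (map h (enum 'S_n)) = #|[set s | h s == v]|.
  by rewrite count_map -sum1_count big_enum_cond /= sum1dep_card.
split=> [e|/seq.permP e v]; last by rewrite -!countE.
by apply/allP => v _; rewrite /= !countE e.
Qed.

Lemma equidist_sym (T : eqType) (f g : 'S_n -> T) : equidistributed f g -> equidistributed g f.
Proof. by move=> e v. Qed.

Lemma equidist_trans (T : eqType) (f g h : 'S_n -> T) :
  equidistributed f g -> equidistributed g h -> equidistributed f h.
Proof. by move=> e1 e2 v; rewrite e1. Qed.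

Lemma equidist_comp (T U : eqType) (h : T -> U) (f g : 'S_n -> T) :
  equidistributed f g -> equidistributed (fun s => h (f s)) (fun s => h (g s)).
Proof.
move/equidistributedP => e; apply/equidistributedP.
by rewrite (map_comp h f) (map_comp h g); apply: perm_map.
Qed.

Lemma equidist_inj (T : eqType) (phi : 'S_n -> 'S_n) (f g : 'S_n -> T) :
  injective phi -> (forall s, f (phi s) = g s) -> equidistributed f g.
Proof.
move=> phi_inj e v; rewrite !card_set_sum (reindex_inj phi_inj) /=.
by apply: eq_bigr => s _; rewrite e.
Qed.

Lemma equidist_sum (R : nmodType) (T : eqType) (f g : 'S_n -> T) (F : T -> R) :
  equidistributed f g -> (\sum_s F (f s) = \sum_s F (g s))%R.
Proof.
have sumE (h : 'S_n -> T) : (\sum_s F (h s) = \sum_(v <- map h (enum 'S_n)) F v)%R.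
  by rewrite big_map big_enum.
by move/equidistributedP => e; rewrite !sumE; apply: perm_big.
Qed.

End Equidistribution.

(** * The product formula *)

Lemma gf_identity_equidist n (s1 s2 s3 t1 t2 t3 : 'S_n -> nat) :
  equidistributed (fun s => (s1 s, s2 s, s3 s)) (fun s => (t1 s, t2 s, t3 s)) ->
  gf_identity s1 s2 s3 -> gf_identity t1 t2 t3.
Proof.
move=> e gf R q x y; rewrite -gf.
by apply/esym/(equidist_sum (fun v : nat * nat * nat => q ^+ v.1.1 * x ^+ v.1.2 * y ^+ v.2)%R e).
Qed.

(** The last position gives [x], the first gives [y q^n], and those between give [[n+1]_q - 1 -
    q^n]; [0 < n] keeps the two ends distinct. *)
Lemma sum_ins_max_weight (R : comNzRingType) (q x y : R) n : 0 < n ->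
  (\sum_(i < n.+1) q ^+ (n - i) * x ^+ (i == ord_max) * y ^+ (i == ord0) =
   x + qint q n.+1 + y * q ^+ n - 1 - q ^+ n)%R.
Proof.
case: n => // n _; rewrite /qint big_ord_recl big_ord_recr /= subnn subn0.
rewrite [in RHS]big_ord_recl [in RHS]big_ord_recr /= !expr0 !expr1 !mulr1 !mul1r.
rewrite [in RHS](reindex_inj rev_ord_inj) /=.
under eq_bigr => i _.
  have -> : (lift ord0 (widen_ord (leqnSn n) i) == ord_max) = false.
    by apply/negP => /eqP/(congr1 val); have := ltn_ord i; rewrite /= /bump /=; lia.
  rewrite !expr0 !mulr1; over.
under [in RHS]eq_bigr => i _.
  have -> : bump 0 (n - i.+1) = n.+1 - bump 0 i by have := ltn_ord i; rewrite /bump /=; lia.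
  over.
set S := (\sum_(i < n) _)%R.
rewrite [(y * _)%R]mulrC -[bump 0 n]/(n.+1).
rewrite -[RHS]/(x + (1 + (S + q ^+ n.+1)) + q ^+ n.+1 * y - 1 - q ^+ n.+1)%R.
have -> : lift ord0 ord_max == ord_max :> 'I_n.+2 by apply/eqP/val_inj.
by rewrite expr1; ring.
Qed.

Lemma gf_identity_inv n : 0 < n -> gf_identity (@ninv n) (@rmin n) (@lmin n).
Proof.
case: n => // n _ R q x y.
(* The weight gained by inserting at [i] is independent of [s], so the sum factors. *)
have recS m : (\sum_(s : 'S_m.+1) q ^+ ninv s * x ^+ rmin s * y ^+ lmin s =
    (\sum_(s : 'S_m) q ^+ ninv s * x ^+ rmin s * y ^+ lmin s) *
    \sum_(i < m.+1) q ^+ (m - i) * x ^+ (i == ord_max) * y ^+ (i == ord0))%R.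
  rewrite (reindex _ (onW_bij _ (ins_max_bij m))) /=.
  rewrite -(pair_bigA _ (fun i s => q ^+ ninv (ins_max i s) * x ^+ rmin (ins_max i s) *
    y ^+ lmin (ins_max i s)))%R /= exchange_big /= big_distrl /=.
  apply: eq_bigr => s _; rewrite big_distrr /=; apply: eq_bigr => i _.
  by rewrite ninv_ins_max rmin_ins_max lmin_ins_max !exprD; ring.
elim: n => [|n IH].
  (* For a single letter the only position is both first and last, which yields the prefactor
     [x y]. *)
  rewrite recS big_geq // mulr1 big_ord_recl big_ord0 /= !expr1 expr0 mul1r addr0.
  rewrite (eq_bigr (fun=> 1%R)) => [|s _].
    rewrite sumr_const -[#|_|](_ : 1 = _) ?mul1r //.
    by rewrite card_Sn.
  rewrite ninv_sum /rmin /lmin !card_set_sum !big_ord0 !expr0 !mulr1 //.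
by rewrite recS sum_ins_max_weight // IH [in RHS]big_nat_recr //= mulrA [n.+2 - 1]subn1.
Qed.

(** * Symmetries *)

Section Symmetries.
Variable n : nat.
Implicit Type s : 'S_n.

Lemma forall_perm s (P : pred 'I_n) : [forall j, P j] = [forall j, P (s j)].
Proof.
apply/forallP/forallP => h j; first exact: h.
by rewrite -[j](permKV s).
Qed.

Lemma card_set_perm s (P : pred 'I_n) : #|[set i | P i]| = #|[set i | P (s i)]|.
Proof. by rewrite !card_set_sum (reindex_inj (@perm_inj _ s)). Qed.

Lemma sum2_perm s (F : 'I_n -> 'I_n -> nat) :
  \sum_i \sum_j F i j = \sum_i \sum_j F (s i) (s j).
Proof.
rewrite (reindex_inj (@perm_inj _ s)) /=; apply: eq_bigr => i _.
by rewrite (reindex_inj (@perm_inj _ s)).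
Qed.

Lemma rev_ltE (i j : 'I_n) : (rev_ord i < rev_ord j) = (j < i).
Proof. by have := ltn_ord i; have := ltn_ord j; rewrite /=; lia. Qed.

Lemma perm_neq_val s (i j : 'I_n) : i <> j :> nat -> s i <> s j :> nat.
Proof. by move=> ne /val_inj/perm_inj e; apply: ne; rewrite e. Qed.

(** Inversion reflects the permutation diagram in the diagonal and swaps the empty lower-right and
    upper-left quadrants; the quadrants that define [lmin] and [rmax] are symmetric. *)
Lemma rmin_inv s : rmin s^-1 = lmax s.
Proof.
rewrite /rmin (card_set_perm s); apply: eq_card => i; rewrite !inE (forall_perm s).
apply: eq_forallb => j; rewrite !permK.
case: (eqVneq i j) => [->|/eqP ne_ij]; first by rewrite !ltnn.
have ne : i <> j :> nat by move/val_inj.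
by have := perm_neq_val (s := s) ne; move: ne; lia.
Qed.

Lemma lmax_inv s : lmax s^-1 = rmin s.
Proof. by rewrite -rmin_inv invgK. Qed.

Lemma lmin_inv s : lmin s^-1 = lmin s.
Proof.
rewrite /lmin (card_set_perm s); apply: eq_card => i; rewrite !inE (forall_perm s).
apply: eq_forallb => j; rewrite !permK.
case: (eqVneq i j) => [->|/eqP ne_ij]; first by rewrite !ltnn.
have ne : i <> j :> nat by move/val_inj.
by have := perm_neq_val (s := s) ne; move: ne; lia.
Qed.

Lemma rmax_inv s : rmax s^-1 = rmax s.
Proof.
rewrite /rmax (card_set_perm s); apply: eq_card => i; rewrite !inE (forall_perm s).
apply: eq_forallb => j; rewrite !permK.
case: (eqVneq i j) => [->|/eqP ne_ij]; first by rewrite !ltnn.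
have ne : i <> j :> nat by move/val_inj.
by have := perm_neq_val (s := s) ne; move: ne; lia.
Qed.

Lemma ninv_inv s : ninv s^-1 = ninv s.
Proof.
rewrite !ninv_sum (sum2_perm s) exchange_big; apply: eq_bigr => i _; apply: eq_bigr => j _.
by rewrite !permK andbC.
Qed.

Lemma cyc_inv s : cyc s^-1 = cyc s.
Proof. by rewrite /cyc porbitsV. Qed.

(** * Reversal and complementation *)

Lemma perm_revE (i : 'I_n) : perm (@rev_ord_inj n) i = rev_ord i.
Proof. exact: permE. Qed.

Lemma revpE s i : revp s i = s (rev_ord i).
Proof. by rewrite /revp permM permE. Qed.

Lemma complE s i : compl s i = rev_ord (s i).
Proof. by rewrite /compl permM permE. Qed.

Lemma revp_inj : injective (@revp n).
Proof. exact: mulgI. Qed.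

Lemma compl_inj : injective (@compl n).
Proof. exact: mulIg. Qed.

Lemma rmin_compl s : rmin (compl s) = rmax s.
Proof. by apply: eq_card => i; rewrite !inE; apply: eq_forallb => j; rewrite !complE rev_ltE. Qed.
Lemma rmax_compl s : rmax (compl s) = rmin s.
Proof. by apply: eq_card => i; rewrite !inE; apply: eq_forallb => j; rewrite !complE rev_ltE. Qed.
Lemma lmin_compl s : lmin (compl s) = lmax s.
Proof. by apply: eq_card => i; rewrite !inE; apply: eq_forallb => j; rewrite !complE rev_ltE. Qed.
Lemma lmax_compl s : lmax (compl s) = lmin s.
Proof. by apply: eq_card => i; rewrite !inE; apply: eq_forallb => j; rewrite !complE rev_ltE. Qed.

Lemma rmin_revp s : rmin (revp s) = lmin s.
Proof.
rewrite /rmin (card_set_perm (perm rev_ord_inj)); apply: eq_card => i; rewrite !inE.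
rewrite (forall_perm (perm rev_ord_inj)); apply: eq_forallb => j.
by rewrite !revpE !perm_revE !rev_ordK rev_ltE.
Qed.
Lemma rmax_revp s : rmax (revp s) = lmax s.
Proof.
rewrite /rmax (card_set_perm (perm rev_ord_inj)); apply: eq_card => i; rewrite !inE.
rewrite (forall_perm (perm rev_ord_inj)); apply: eq_forallb => j.
by rewrite !revpE !perm_revE !rev_ordK rev_ltE.
Qed.
Lemma lmin_revp s : lmin (revp s) = rmin s.
Proof.
rewrite /lmin (card_set_perm (perm rev_ord_inj)); apply: eq_card => i; rewrite !inE.
rewrite (forall_perm (perm rev_ord_inj)); apply: eq_forallb => j.
by rewrite !revpE !perm_revE !rev_ordK rev_ltE.
Qed.
Lemma lmax_revp s : lmax (revp s) = rmax s.
Proof.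
rewrite /lmax (card_set_perm (perm rev_ord_inj)); apply: eq_card => i; rewrite !inE.
rewrite (forall_perm (perm rev_ord_inj)); apply: eq_forallb => j.
by rewrite !revpE !perm_revE !rev_ordK rev_ltE.
Qed.

Lemma ninv_compl s : ninv (compl s) = coinv s.
Proof.
suff e : ninv (compl s) + ninv s = 'C(n, 2) by rewrite /coinv -e addnK.
(* After reversing the sum, row [i] counts the positions to its right; each such pair is an
   inversion of exactly one of [s] and [compl s]. *)
rewrite -bin2_sum big_mkord (reindex_inj rev_ord_inj) !ninv_sum -big_split.
apply: eq_bigr => i _; rewrite -big_split /= -(sum_geq_ord n i.+1); apply: eq_bigr => j _.
rewrite !complE rev_ltE; case: ltnP => //= lt_ij.
have ne : i <> j :> nat by move: lt_ij; lia.
by have := perm_neq_val (s := s) ne; lia.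
Qed.

Lemma ninv_revp s : ninv (revp s) = coinv s.
Proof.
rewrite -ninv_compl !ninv_sum (sum2_perm (perm rev_ord_inj)) exchange_big.
apply: eq_bigr => i _; apply: eq_bigr => j _.
by rewrite !revpE !perm_revE !rev_ordK rev_ltE !complE rev_ltE.
Qed.

Lemma coinv_compl s : coinv (compl s) = ninv s.
Proof. by rewrite {1}/coinv ninv_compl subKn // ninv_le. Qed.

Lemma coinv_revp s : coinv (revp s) = ninv s.
Proof. by rewrite {1}/coinv ninv_revp subKn // ninv_le. Qed.

(** Reverse-complement sends the pair of positions [(i, j)] to [(rev_ord j, rev_ord i)] and keeps
    descents, so a descent at [i.+1] moves to [n - i.+1]. *)
Lemma rmajE s : rmaj s = \sum_(i in Des s) (n - i.+1).
Proof.
rewrite /rmaj /maj !sum_Des (sum2_perm (perm rev_ord_inj)) exchange_big.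
apply: eq_bigr => i _; apply: eq_bigr => j _.
rewrite !revpE !perm_revE !complE !rev_ordK rev_ltE /=.
have -> : (n - i.+1 == (n - j.+1).+1) = (j == i.+1 :> nat).
  by have := ltn_ord i; have := ltn_ord j; lia.
by case: eqP => //= ej; have := ltn_ord j; rewrite ej; case: ifP => // _; lia.
Qed.

Lemma chgE s : chg s = rmaj s^-1.
Proof. by rewrite rmajE. Qed.

(** Reversing [s] complements its inverse, which exchanges ascents and descents there. *)
Lemma cochgE s : cochg s = chg (revp s).
Proof.
rewrite /cochg /chg; apply: eq_bigl => i; rewrite !inE.
have -> : (revp s)^-1%g = compl s^-1.
  apply/permP => j; apply: (@perm_inj _ (revp s)).
  by rewrite permKV revpE complE rev_ordK permKV.
apply/andP/existsP => [[lt_i /existsPn h]|[j /andP[/eqP ej]]].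
  exists (Ordinal lt_i); rewrite eqxx /= !complE rev_ltE.
  have := h (Ordinal lt_i); rewrite eqxx /= -leqNgt leq_eqVlt val_eqE (inj_eq perm_inj).
  by rewrite -val_eqE /= ltn_eqF.
rewrite !complE rev_ltE => lt_j; split; first by rewrite -ej.
apply/existsPn => k; apply/negP => /andP[/eqP ek].
have -> : k = j by apply: val_inj; rewrite /= ek ej.
by rewrite ltnNge ltnW.
Qed.

End Symmetries.

(** * All equidistributions from the two bijections and the symmetries *)

Theorem theorem5p2 (n : nat) (n_gt0 : 0 < n) :
  (
   (* (2) *)
      equidistributed (fun s : 'S_n => (ninv s, rmin s, lmin s, lmax s))
        (fun s : 'S_n => (sor s, cyc s, lmic1 s, lmax s)) /\
   (* (3) *)
      equidistributed (fun s : 'S_n => (ninv s, rmin s, lmin s, lmax s))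
        (fun s : 'S_n => (ninv s, lmax s, lmin s, rmin s)) /\
   (* (4) *)
      equidistributed (fun s : 'S_n => (ninv s, rmin s, lmin s, lmax s))
        (fun s : 'S_n => (ninv s, rmin s, rmax s, lmax s)) /\
   (* (5) *)
      equidistributed (fun s : 'S_n => (ninv s, rmin s, lmin s, lmax s))
        (fun s : 'S_n => (ninv s, lmax s, rmax s, rmin s)) /\
   (* (6) *)
      equidistributed (fun s : 'S_n => (ninv s, rmin s, lmin s, lmax s))
        (fun s : 'S_n => (coinv s, lmin s, rmin s, rmax s)) /\
   (* (7) *)
      equidistributed (fun s : 'S_n => (ninv s, rmin s, lmin s, lmax s))
        (fun s : 'S_n => (coinv s, rmax s, lmax s, lmin s)) /\
   (* (8) *)
      equidistributed (fun s : 'S_n => (ninv s, rmin s, lmin s, lmax s))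
        (fun s : 'S_n => (coinv s, rmax s, rmin s, lmin s)) /\
   (* (9) *)
      equidistributed (fun s : 'S_n => (ninv s, rmin s, lmin s, lmax s))
        (fun s : 'S_n => (coinv s, lmin s, lmax s, rmax s)) /\
   (* (10) *)
      equidistributed (fun s : 'S_n => (ninv s, rmin s, lmin s, lmax s))
        (fun s : 'S_n => (sor s, lmax s, lmic1 s, cyc s)) /\
   (* (11) *)
      equidistributed (fun s : 'S_n => (ninv s, rmin s, lmin s))
        (fun s : 'S_n => (cosor s, lmic1 s, cyc s)) /\
   (* (12) *)
      equidistributed (fun s : 'S_n => (ninv s, lmin s, lmax s))
        (fun s : 'S_n => (cosor s, lmax s, lmic1 s)) /\
   (* (13) *)
      equidistributed (fun s : 'S_n => (ninv s, lmin s, lmax s))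
        (fun s : 'S_n => (cosor s, cyc s, lmic1 s)) /\
   (* (14) *)
      equidistributed (fun s : 'S_n => (ninv s, rmin s, lmin s))
        (fun s : 'S_n => (cosor s, lmic1 s, lmax s)) /\
   (* (15) *)
      equidistributed (fun s : 'S_n => (rmin s, lmax s))
        (fun s : 'S_n => (cyc s, rmin s)) /\
   (* (16) *)
      equidistributed (fun s : 'S_n => (rmin s, lmax s))
        (fun s : 'S_n => (rmin s, cyc s)) /\
   (* (17) *)
      equidistributed (fun s : 'S_n => (ninv s, rmin s, lmin s))
        (fun s : 'S_n => (maj s, rmin s, rmax s)) /\
   (* (18) *)
      equidistributed (fun s : 'S_n => (ninv s, rmin s, lmin s))
        (fun s : 'S_n => (imaj s, lmax s, rmax s)) /\
   (* (19) *)
      equidistributed (fun s : 'S_n => (ninv s, rmin s, lmin s))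
        (fun s : 'S_n => (rmaj s, lmax s, lmin s)) /\
   (* (20) *)
      equidistributed (fun s : 'S_n => (ninv s, rmin s, lmin s))
        (fun s : 'S_n => (chg s, rmin s, lmin s)) /\
   (* (21) *)
      equidistributed (fun s : 'S_n => (ninv s, rmin s, lmin s))
        (fun s : 'S_n => (cochg s, lmin s, rmin s))
  ) /\
  (
   (* (1) *) gf_identity (@ninv n) (@rmin n) (@lmin n) /\
   (* (2) *) gf_identity (@sor n) (@cyc n) (@lmic1 n) /\
   (* (3) *) gf_identity (@ninv n) (@lmax n) (@lmin n) /\
   (* (4) *) gf_identity (@ninv n) (@rmin n) (@rmax n) /\
   (* (5) *) gf_identity (@ninv n) (@lmax n) (@rmax n) /\
   (* (6) *) gf_identity (@coinv n) (@lmin n) (@rmin n) /\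
   (* (7) *) gf_identity (@coinv n) (@rmax n) (@lmax n) /\
   (* (8) *) gf_identity (@coinv n) (@rmax n) (@rmin n) /\
   (* (9) *) gf_identity (@coinv n) (@lmin n) (@lmax n) /\
   (* (10) *) gf_identity (@sor n) (@lmax n) (@lmic1 n) /\
   (* (11) *) gf_identity (@cosor n) (@lmic1 n) (@cyc n) /\
   (* (14) *) gf_identity (@cosor n) (@lmic1 n) (@lmax n) /\
   (* (17) *) gf_identity (@maj n) (@rmin n) (@rmax n) /\
   (* (18) *) gf_identity (@imaj n) (@lmax n) (@rmax n) /\
   (* (19) *) gf_identity (@rmaj n) (@lmax n) (@lmin n) /\
   (* (20) *) gf_identity (@chg n) (@rmin n) (@lmin n) /\
   (* (21) *) gf_identity (@cochg n) (@lmin n) (@rmin n)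
  ).

Proof.
set quad := fun s : 'S_n => (ninv s, rmin s, lmin s, lmax s).
have E2 : equidistributed quad (fun s => (sor s, cyc s, lmic1 s, lmax s)).
  have [f f_inj fP] := sort_to_inv n; apply: (equidist_inj f_inj) => s.
  have [e1 e2 e3 e4] := fP s; rewrite /quad e1 e2 e3 /lmax; congr (_, _).
  by apply: eq_card => i; rewrite !inE; apply: e4.
have E3 : equidistributed quad (fun s => (ninv s, lmax s, lmin s, rmin s)).
  by apply: (equidist_inj invg_inj) => s; rewrite /quad ninv_inv rmin_inv lmin_inv lmax_inv.
(* The half-turn of the diagram preserves [ninv], swaps [rmin] with [lmax] and [lmin] with
   [rmax]. *)
pose rc (s : 'S_n) := revp (compl s).
have rc_inj : injective rc by apply: inj_comp (@revp_inj n) (@compl_inj n).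
have ninv_rc s : ninv (rc s) = ninv s by rewrite ninv_revp coinv_compl.
have rmin_rc s : rmin (rc s) = lmax s by rewrite rmin_revp lmin_compl.
have lmax_rc s : lmax (rc s) = rmin s by rewrite lmax_revp rmax_compl.
have lmin_rc s : lmin (rc s) = rmax s by rewrite lmin_revp rmin_compl.
have rmax_rc s : rmax (rc s) = lmin s by rewrite rmax_revp lmax_compl.
have E4 : equidistributed quad (fun s => (ninv s, rmin s, rmax s, lmax s)).
  by apply: (equidist_trans E3); apply: (equidist_inj rc_inj) => s;
    rewrite ninv_rc lmax_rc lmin_rc rmin_rc.
have E5 : equidistributed quad (fun s => (ninv s, lmax s, rmax s, rmin s)).
  by apply: (equidist_inj rc_inj) => s; rewrite /quad ninv_rc lmax_rc lmin_rc rmin_rc.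
have E6 : equidistributed quad (fun s => (coinv s, lmin s, rmin s, rmax s)).
  by apply: (equidist_inj (@revp_inj n)) => s; rewrite /quad ninv_revp rmin_revp lmin_revp lmax_revp.
have E7 : equidistributed quad (fun s => (coinv s, rmax s, lmax s, lmin s)).
  by apply: (equidist_inj (@compl_inj n)) => s;
    rewrite /quad ninv_compl rmin_compl lmin_compl lmax_compl.
have E8 : equidistributed quad (fun s => (coinv s, rmax s, rmin s, lmin s)).
  by apply: (equidist_trans E3); apply: (equidist_inj (@revp_inj n)) => s;
    rewrite ninv_revp rmin_revp lmin_revp lmax_revp.
have E9 : equidistributed quad (fun s => (coinv s, lmin s, lmax s, rmax s)).
  by apply: (equidist_trans E3); apply: (equidist_inj (@compl_inj n)) => s;
    rewrite ninv_compl rmin_compl lmin_compl lmax_compl.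
have E10 : equidistributed quad (fun s => (sor s, lmax s, lmic1 s, cyc s)).
  (* What remains is [E2] with its second and fourth entries exchanged on both sides. *)
  apply: (equidist_trans E3).
  exact: (equidist_comp (fun v : nat * nat * nat * nat => (v.1.1.1, v.2, v.1.2, v.1.1.2)) E2).
(* Postcomposed with [E2] or [E10], these complement the first entry and drop the fourth. *)
pose swap (v : nat * nat * nat * nat) := ('C(n, 2) - v.1.1.1, v.1.2, v.1.1.2).
pose keep (v : nat * nat * nat * nat) := ('C(n, 2) - v.1.1.1, v.1.1.2, v.1.2).
have Eswap : equidistributed (fun s : 'S_n => (ninv s, rmin s, lmin s))
    (fun s : 'S_n => (coinv s, lmin s, rmin s)).
  by apply: (equidist_inj (@revp_inj n)) => s; rewrite ninv_revp rmin_revp lmin_revp.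
have Ekeep : equidistributed (fun s : 'S_n => (ninv s, lmin s, lmax s))
    (fun s : 'S_n => (coinv s, rmin s, lmin s)).
  (* Inversion followed by reversal sends [rmin] to [lmin] and [lmin] to [lmax]. *)
  have revV_inj : injective (fun s : 'S_n => revp s^-1).
    exact: inj_comp (@revp_inj n) invg_inj.
  apply/equidist_sym/(equidist_inj revV_inj) => s.
  by rewrite coinv_revp rmin_revp lmin_revp ninv_inv lmin_inv rmin_inv.
have E11 : equidistributed (fun s : 'S_n => (ninv s, rmin s, lmin s))
    (fun s => (cosor s, lmic1 s, cyc s)).
  by apply: (equidist_trans Eswap); exact: (equidist_comp swap E2).
have E12 : equidistributed (fun s : 'S_n => (ninv s, lmin s, lmax s))
    (fun s => (cosor s, lmax s, lmic1 s)).
  by apply: (equidist_trans Ekeep); exact: (equidist_comp keep E10).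
have E13 : equidistributed (fun s : 'S_n => (ninv s, lmin s, lmax s))
    (fun s => (cosor s, cyc s, lmic1 s)).
  by apply: (equidist_trans Ekeep); exact: (equidist_comp keep E2).
have E14 : equidistributed (fun s : 'S_n => (ninv s, rmin s, lmin s))
    (fun s => (cosor s, lmic1 s, lmax s)).
  by apply: (equidist_trans Eswap); exact: (equidist_comp swap E10).
have E15 : equidistributed (fun s : 'S_n => (rmin s, lmax s)) (fun s => (cyc s, rmin s)).
  (* Projecting [E2] gives the pair [cyc], [lmax]; inversion fixes [cyc] and turns [lmax] into
     [rmin]. *)
  apply: equidist_trans (equidist_comp (fun v : nat * nat * nat * nat => (v.1.1.2, v.2)) E2) _.
  by apply: (equidist_inj invg_inj) => s; rewrite cyc_inv lmax_inv.
have E16 : equidistributed (fun s : 'S_n => (rmin s, lmax s)) (fun s => (rmin s, cyc s)).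
  apply: equidist_trans (equidist_comp (fun v : nat * nat * nat * nat => (v.1.1.2, v.2)) E10) _.
  by apply: (equidist_inj invg_inj) => s; rewrite cyc_inv lmax_inv.
have E17 : equidistributed (fun s : 'S_n => (ninv s, rmin s, lmin s))
    (fun s => (maj s, rmin s, rmax s)).
  (* [fst] drops the fourth entry of [E4]; Foata's map then replaces [ninv] by [maj]. *)
  apply: equidist_trans (equidist_comp fst E4) _.
  have [f f_inj fP] := maj_to_inv n; apply: (equidist_inj f_inj) => s.
  by have [/= -> -> ->] := fP s.
have E18 : equidistributed (fun s : 'S_n => (ninv s, rmin s, lmin s))
    (fun s => (imaj s, lmax s, rmax s)).
  by apply: (equidist_trans E17); apply: (equidist_inj invg_inj) => s; rewrite rmin_inv rmax_inv.
have E19 : equidistributed (fun s : 'S_n => (ninv s, rmin s, lmin s))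
    (fun s => (rmaj s, lmax s, lmin s)).
  (* [rmaj s] is [maj (rc s)] by definition. *)
  by apply: (equidist_trans E17); apply: (equidist_inj rc_inj) => s; rewrite rmin_rc rmax_rc.
have E20 : equidistributed (fun s : 'S_n => (ninv s, rmin s, lmin s))
    (fun s => (chg s, rmin s, lmin s)).
  by apply: (equidist_trans E19); apply: (equidist_inj invg_inj) => s; rewrite -chgE lmax_inv lmin_inv.
have E21 : equidistributed (fun s : 'S_n => (ninv s, rmin s, lmin s))
    (fun s => (cochg s, lmin s, rmin s)).
  by apply: (equidist_trans E20); apply: (equidist_inj (@revp_inj n)) => s;
    rewrite -cochgE rmin_revp lmin_revp.
have gf := gf_identity_inv n_gt0.
split; first by do 19! [split=> //].
have gf4 (s1 s2 s3 s4 : 'S_n -> nat) :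
    equidistributed quad (fun s => (s1 s, s2 s, s3 s, s4 s)) -> gf_identity s1 s2 s3.
  by move=> /(equidist_comp fst) e; apply: gf_identity_equidist e gf.
have gf3 (s1 s2 s3 : 'S_n -> nat) :
    equidistributed (fun s : 'S_n => (ninv s, rmin s, lmin s)) (fun s => (s1 s, s2 s, s3 s)) ->
    gf_identity s1 s2 s3.
  by move=> e; apply: gf_identity_equidist e gf.
split; first exact: gf.
split; first exact: gf4 E2.
split; first exact: gf4 E3.
split; first exact: gf4 E4.
split; first exact: gf4 E5.
split; first exact: gf4 E6.
split; first exact: gf4 E7.
split; first exact: gf4 E8.
split; first exact: gf4 E9.
split; first exact: gf4 E10.
split; first exact: gf3 E11.
split; first exact: gf3 E14.
split; first exact: gf3 E17.
split; first exact: gf3 E18.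
split; first exact: gf3 E19.
split; first exact: gf3 E20.
exact: gf3 E21.
Qed.
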